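(* Let $p$ be an odd prime and $r$ a positive integer. Then \[ \sum_{\substack{i+j+k=2p^{r}\\ i,j,k\in \mathcal{P}_{p}}}\frac{(-1)^{i}}{ijk}\equiv p^{r-1}B_{p-3} \pmod{p^{r}}. \]
   Context: $\mathcal{P}_{n}$ denotes the set of positive integers coprime to $n$; the sum runs over ordered triples of positive integers $(i,j,k)$, each coprime to $p$, with $i+j+k=2p^r$. The Bernoulli numbers $B_k$ are defined by $B_0=1$ and $\sum_{i=0}^{n}\binom{n+1}{i}B_{i}=0$ for $n\geq 1$. Congruences between rational numbers whose denominators are coprime to $p$ are understood in the ring of $p$-integral rationals: $a\equiv b \pmod{p^s}$ means $(a-b)/p^s$ has denominator coprime to $p$. *)

(* Defs.v *)
From mathcomp Require Export all_boot all_order all_algebra.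

Set Implicit Arguments.
Unset Strict Implicit.
Unset Printing Implicit Defensive.

Import Order.TTheory GRing.Theory Num.Theory.
Local Open Scope ring_scope.

Definition coprime_pos (n : nat) : pred nat :=
  [pred m | (0 < m)%N && coprime m n].

(* [:: B_0; ...; B_(n-1)]; each new term is obtained by solving the defining
   recurrence for its last summand 'C(n.+1, n) B_n = (n + 1) B_n. *)
Fixpoint bernoulli_seq (n : nat) : seq rat :=
  if n is m.+1 then
    let s := bernoulli_seq m in
    rcons s (if m is 0 then 1
             else - (m.+1%:R)^-1 * \sum_(i < m) 'C(m.+1, i)%:R * s`_i)
  else [::].

Definition bernoulli (n : nat) : rat := (bernoulli_seq n.+1)`_n.

Definition p_integral (p : nat) (x : rat) : bool := coprime `|denq x|%N p.

Definition eqmodp (p s : nat) (a b : rat) : bool :=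
  p_integral p ((a - b) / (p ^ s)%N%:R).

Lemma size_bernoulli_seq n : size (bernoulli_seq n) = n.
Proof. by elim: n => //= n IH; rewrite size_rcons IH. Qed.

Lemma nth_bernoulli_seq n i : (i < n)%N -> (bernoulli_seq n)`_i = bernoulli i.
Proof.
elim: n => // n IH; rewrite ltnS leq_eqVlt => /orP[/eqP-> //|lin].
by rewrite /= nth_rcons size_bernoulli_seq lin IH.
Qed.

Lemma bernoulli0 : bernoulli 0 = 1.
Proof. by []. Qed.

Lemma bernoulli_rec n : (1 <= n)%N ->
  \sum_(i < n.+1) 'C(n.+1, i)%:R * bernoulli i = 0.
Proof.
case: n => // n _; rewrite big_ord_recr /=.
have -> : bernoulli n.+1 = - (n.+2%:R)^-1 *
    \sum_(i < n.+1) 'C(n.+2, i)%:R * bernoulli i.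
  have bsS : bernoulli_seq n.+2 = rcons (bernoulli_seq n.+1)
      (- (n.+2%:R)^-1 *
         \sum_(i < n.+1) 'C(n.+2, i)%:R * (bernoulli_seq n.+1)`_i) by [].
  rewrite {1}/bernoulli bsS nth_rcons size_bernoulli_seq ltnn eqxx.
  by congr (_ * _); apply: eq_bigr => i _; rewrite nth_bernoulli_seq.
by rewrite binSn mulrA mulrN mulfV ?pnatr_eq0 // mulN1r subrr.
Qed.

(* Main.v *)
From HB Require Import structures.
Require Import Defs.
From mathcomp Require Import ring zify.

Set Implicit Arguments.
Unset Strict Implicit.
Unset Printing Implicit Defensive.

Import Order.TTheory GRing.Theory Num.Theory.
Local Open Scope ring_scope.

(* Put q = p^r and work in Z/q, writing h(x) = 1/x for units and h(x) = 0
   otherwise. The sum over i + j + k = 2q is the sum over i <= 2q of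
   (-1)^i h(i) C(2q - i), where C(n) is the sum of h(j) h(n - j) over j <= n,
   and C(q + n) = K(n) + C(n) with K the cyclic convolution h * h on Z/q. As q is
   odd, the halves i < q and i >= q combine to the sum over i < q of
   (-1)^i h(i) K(-i). Scaling gives K(x) = K(1)/x^2 for a unit x, and partial
   fractions give K(1) = -2 p^(r-1). What remains is
   -2 p^(r-1) sum_(i < q) (-1)^i i^(-3), where the last factor matters only mod p
   and i^(-3) may be replaced by i^(p-4) (by i when p = 3).

   The alternating power sums sum_(a < q) (-1)^a a^n satisfy in Z/q the recurrence
   defining the values E_n(0) = 2 (1 - 2^(n+1)) B_(n+1) / (n+1) of the Euler
   polynomials, hence are their reductions mod q; n = p - 4 yields B_(p-3). *)

(** * Umbral calculus: the linear functional sending X^n to B_n, and the numbers E_n(0) *)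

Definition umbral (f : {poly rat}) : rat := \sum_(i < size f) f`_i * bernoulli i.

Lemma umbral_widen (n : nat) (f : {poly rat}) : (size f <= n)%N ->
  umbral f = \sum_(i < n) f`_i * bernoulli i.
Proof.
move=> le_fn; rewrite /umbral (big_ord_widen n (fun i => f`_i * bernoulli i)) //.
rewrite big_mkcond /=; apply: eq_bigr => i _.
by case: ltnP => // le_fi; rewrite nth_default ?mul0r.
Qed.

Lemma umbral_is_scalar : scalar umbral.
Proof.
move=> a f g; pose n := maxn (size (a *: f + g)) (maxn (size f) (size g)).
rewrite (@umbral_widen n (a *: f + g)) ?leq_maxl //.
rewrite (@umbral_widen n f) ?(@umbral_widen n g); try by rewrite /n; lia.
rewrite mulr_sumr -big_split; apply: eq_bigr => i _ /=.
by rewrite coefD coefZ mulrDl mulrA.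
Qed.

HB.instance Definition _ :=
  GRing.isLinear.Build rat {poly rat} rat *%R umbral umbral_is_scalar.

Lemma umbralXn (n : nat) : umbral 'X^n = bernoulli n.
Proof.
rewrite /umbral size_polyXn big_ord_recr /= coefXn eqxx mul1r big1 ?add0r //.
by move=> i _; rewrite coefXn ltn_eqF ?mul0r.
Qed.

Lemma umbral_affine (c : rat) (n : nat) :
  umbral ((1 + c *: 'X) ^+ n) =
  \sum_(i < n.+1) 'C(n, i)%:R * (c ^+ i * bernoulli i).
Proof.
rewrite exprDn raddf_sum; apply: eq_bigr => i _ /=.
by rewrite expr1n mul1r exprZn raddfMn /= linearZ /= umbralXn mulr_natl.
Qed.

Lemma umbral_add1Xn (n : nat) :
  umbral ((1 + 'X) ^+ n) = bernoulli n + (n == 1)%:R.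
Proof.
rewrite -['X]scale1r umbral_affine.
case: n => [|[|n]]; first by rewrite big_ord1.
  by rewrite !big_ord_recr big_ord0 /= bernoulli0 bin0 binn; ring.
rewrite big_ord_recr /= binn expr1n !mul1r addr0 addrC.
under eq_bigr do rewrite expr1n mul1r.
by rewrite bernoulli_rec // addr0.
Qed.

(** Taken at n + 1, the hypothesis loses [c n.+1] on both sides and leaves [c n] with the nonzero
    coefficient n + 1, so strong induction determines [c]. *)
Lemma bernoulli_unique (c : nat -> rat) :
  (forall n, \sum_(i < n.+1) 'C(n, i)%:R * c i = c n + (n == 1)%:R) ->
  forall n, c n = bernoulli n.
Proof.
move=> cE.
have sumE (d : nat -> rat) (n : nat) :
    \sum_(i < n.+1) 'C(n, i)%:R * d i = d n + (n == 1)%:R ->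
    \sum_(i < n) 'C(n, i)%:R * d i = (n == 1)%:R.
  by rewrite big_ord_recr /= binn mul1r addrC => /addrI.
elim/ltn_ind=> n IHn; have := sumE _ _ (cE n.+1).
have <- : \sum_(i < n.+1) 'C(n.+1, i)%:R * bernoulli i = (n.+1 == 1)%:R.
  apply: sumE; rewrite -umbral_add1Xn -['X]scale1r umbral_affine.
  by apply: eq_bigr => i _; rewrite expr1n mul1r.
rewrite !big_ord_recr /= binSn.
rewrite (eq_bigr (fun i : 'I_n => 'C(n.+1, i)%:R * bernoulli i)) => [|i _].
  by move/addrI/mulfI; apply; rewrite pnatr_eq0.
by rewrite IHn.
Qed.

(** This is the value 2^n B_n(1/2). The average [c] of 2^n B_n and (1 + 2B)^n satisfies the
    Bernoulli recurrence: the binomial transform turns the first into the second, and the second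
    into (2 + 2B)^n = 2^n (B_n + [n = 1]). *)
Lemma umbral_add1_2Xn (n : nat) :
  umbral ((1 + 2 *: 'X) ^+ n) = (2 - 2 ^+ n) * bernoulli n.
Proof.
pose c n := (2 ^+ n * bernoulli n + umbral ((1 + 2 *: 'X) ^+ n)) / 2.
suff cE : c n = bernoulli n.
  have -> : umbral ((1 + 2 *: 'X) ^+ n) = 2 * c n - 2 ^+ n * bernoulli n.
    by rewrite /c; field.
  by rewrite cE mulrBl.
apply: bernoulli_unique => {}n; rewrite /c.
under eq_bigr do rewrite mulrA mulrDr.
rewrite -mulr_suml big_split /= -umbral_affine.
have -> : \sum_(i < n.+1) 'C(n, i)%:R * umbral ((1 + 2 *: 'X) ^+ i) =
    umbral ((2 *: (1 + 'X)) ^+ n).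
  have -> : 2 *: (1 + 'X) = 1 + (1 + 2 *: 'X) :> {poly rat}.
    by rewrite scalerDr scaler_nat mulr2n addrA.
  rewrite exprDn raddf_sum; apply: eq_bigr => i _ /=.
  by rewrite expr1n mul1r raddfMn /= mulr_natl.
rewrite exprZn linearZ /= umbral_add1Xn.
by case: n => [|[|n]] /=; field.
Qed.

(* [euler0 n] is E_n(0), for the n-th Euler polynomial E_n. *)
Definition euler0 (n : nat) : rat := (2 - 2 ^+ n.+2) * bernoulli n.+1 / n.+1%:R.

(** Amounts to E_n(0) + E_n(1) = 2 0^n. After multiplication by n + 1, absorption (n + 1) C(n, i) =
    (i + 1) C(n + 1, i + 1) gives a sum over Bernoulli numbers, whose extra term j = 0 vanishes as 2
    - 2^1 = 0. *)
Lemma euler0_rec (n : nat) :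
  euler0 n + \sum_(i < n.+1) 'C(n, i)%:R * euler0 i = 2 * (n == 0)%:R.
Proof.
have n1_neq0 : n.+1%:R != 0 :> rat by rewrite pnatr_eq0.
apply: (mulfI n1_neq0); rewrite mulrDr mulr_sumr.
have -> : \sum_(i < n.+1) n.+1%:R * ('C(n, i)%:R * euler0 i) =
    \sum_(j < n.+2) 'C(n.+1, j)%:R * ((2 - 2 ^+ j.+1) * bernoulli j).
  rewrite [RHS]big_ord_recl /= subrr mul0r mulr0 add0r.
  apply: eq_bigr => i _; rewrite /euler0 /bump /= add1n.
  have i1_neq0 : i.+1%:R != 0 :> rat by rewrite pnatr_eq0.
  have := congr1 (fun m => m%:R : rat) (mul_bin_diag n.+1 i).
  rewrite /= !natrM => binE; rewrite mulrA binE.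
  by field; rewrite nat1r.
have -> : \sum_(j < n.+2) 'C(n.+1, j)%:R * ((2 - 2 ^+ j.+1) * bernoulli j) =
    2 * umbral ((1 + 'X) ^+ n.+1) - 2 * umbral ((1 + 2 *: 'X) ^+ n.+1).
  rewrite -{1}['X]scale1r !umbral_affine -mulrBr -sumrB mulr_sumr.
  by apply: eq_bigr => i _; rewrite expr1n exprS; ring.
rewrite umbral_add1Xn umbral_add1_2Xn /euler0 eqSS !exprS.
by case: n n1_neq0 => [|n] n1_neq0 /=; field; rewrite -?natrD.
Qed.

(** * Reduction of rationals modulo q *)

(* The graph of the reduction map to Z/q: as a relation it carries the
   integrality of [x] at the primes dividing [q] along with the value. *)
Definition reduces (q : nat) (x : rat) (v : 'Z_q) : Prop :=
  exists (n : int) (d : nat),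
    [/\ coprime d q, x * d%:R = n%:~R & v * d%:R = n%:~R].

Lemma reduces_nat (q n : nat) : @reduces q n%:R n%:R.
Proof. by exists n%:Z, 1%N; rewrite coprime1n !mulr1. Qed.

Lemma reducesD (q : nat) (x y : rat) (v w : 'Z_q) :
  reduces x v -> reduces y w -> reduces (x + y) (v + w).
Proof.
move=> [n [d [cd xE vE]]] [m [e [ce yE wE]]].
exists (n * e%:Z + m * d%:Z), (d * e)%N.
rewrite coprimeMl cd ce !rmorphD !rmorphM /= -xE -yE -vE -wE -!pmulrn.
by split=> //; ring.
Qed.

Lemma reducesM (q : nat) (x y : rat) (v w : 'Z_q) :
  reduces x v -> reduces y w -> reduces (x * y) (v * w).
Proof.
move=> [n [d [cd xE vE]]] [m [e [ce yE wE]]].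
exists (n * m), (d * e)%N.
rewrite coprimeMl cd ce !rmorphM /= -xE -yE -vE -wE.
by split=> //; ring.
Qed.

Lemma reducesN (q : nat) (x : rat) (v : 'Z_q) :
  reduces x v -> reduces (- x) (- v).
Proof.
move=> [n [d [cd xE vE]]]; exists (- n), d.
by rewrite !rmorphN /= -xE -vE !mulNr.
Qed.

Lemma reduces_sum (q : nat) (I : Type) (s : seq I) (P : pred I)
    (F : I -> rat) (G : I -> 'Z_q) :
  (forall i, P i -> reduces (F i) (G i)) ->
  reduces (\sum_(i <- s | P i) F i) (\sum_(i <- s | P i) G i).
Proof.
move=> FG; apply: (big_ind2 (@reduces q)) => //; first exact: (reduces_nat q 0).
by move=> x v y w; apply: reducesD.
Qed.

Lemma reduces_sign (q n : nat) : @reduces q ((-1) ^+ n) ((-1) ^+ n).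
Proof.
elim: n => [|n IHn]; first exact: (reduces_nat q 1).
by rewrite !exprS; apply: reducesM IHn; apply/reducesN/(reduces_nat q 1).
Qed.

Lemma unitr_natZp (q d : nat) : (1 < q)%N -> coprime d q ->
  (d%:R : 'Z_q) \is a GRing.unit.
Proof. by move=> q_gt1; rewrite unitZpE // coprime_sym. Qed.

Lemma reduces_div (q d : nat) (x : rat) (v : 'Z_q) :
  (1 < q)%N -> coprime d q -> reduces x v -> reduces (x / d%:R) (v / d%:R).
Proof.
move=> q_gt1 cd [n [e [ce xE vE]]]; exists n, (d * e)%N.
have d_gt0 : (0 < d)%N.
  by case: d cd => //; rewrite /coprime gcd0n => /eqP q1; rewrite q1 in q_gt1.
rewrite coprimeMl cd ce !natrM !mulrA !divrK ?unitr_natZp //.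
by rewrite unitfE pnatr_eq0 -lt0n.
Qed.

Lemma intr_Zp_eq0 (q : nat) (n : int) : (1 < q)%N ->
  (n%:~R == 0 :> 'Z_q) = (q%:Z %| n)%Z.
Proof.
move=> q_gt1.
have natE (k : nat) : (k%:R == 0 :> 'Z_q) = (q %| k)%N.
  by rewrite -(inj_eq val_inj) /= val_Zp_nat.
by case: n => k; rewrite dvdzE ?NegzE ?rmorphN ?oppr_eq0 /= -pmulrn natE.
Qed.

(** From x d = q m, the quotient y = x / q satisfies y d = m, so its reduced denominator divides d,
    which is coprime to q. *)
Lemma reduces0_p_integral (q : nat) (x : rat) :
  (1 < q)%N -> @reduces q x 0 -> p_integral q (x / q%:R).
Proof.
move=> q_gt1 [n [d [cd xE]]]; rewrite mul0r => /esym/eqP.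
rewrite intr_Zp_eq0 // => /dvdzP[m nE].
have q_neq0 : q%:R != 0 :> rat by rewrite pnatr_eq0 -lt0n ltnW.
set y := x / _; have yE : y * d%:R = m%:~R.
  by apply: (mulIf q_neq0); rewrite /y mulrAC divfK // xE nE rmorphM.
have : numq y * d%:Z = m * denq y.
  apply: (@intr_inj rat); rewrite !rmorphM /= -yE -{2}(divq_num_den y).
  by rewrite mulrAC divfK // intr_eq0 denq_neq0.
move/(congr1 absz); rewrite !abszM /= => dE.
rewrite /p_integral; apply: coprime_dvdl cd.
rewrite -(@Gauss_dvdr _ `|numq y|) 1?coprime_sym ?coprime_num_den //.
by rewrite dE dvdn_mull.
Qed.

Lemma reduces_eqmodp (p r : nat) (x y : rat) (v : 'Z_(p ^ r)) :
  (1 < p ^ r)%N -> (0 < r)%N -> reduces x v -> reduces y v -> eqmodp p r x y.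
Proof.
move=> q_gt1 r_gt0 xv yv.
have : p_integral (p ^ r) ((x - y) / (p ^ r)%:R).
  by apply: reduces0_p_integral => //; rewrite -(subrr v); apply/reducesD/reducesN.
by rewrite /eqmodp /p_integral coprime_pexpr.
Qed.

(** * Alternating power sums modulo q *)

Definition alt_power_sum (q n : nat) : 'Z_q := \sum_(a < q) (-1) ^+ a * a%:R ^+ n.

Lemma alt_sum_telescope (R : pzRingType) (f : nat -> R) (m : nat) :
  \sum_(a < m) (-1) ^+ a * (f a + f a.+1) = f 0 - (-1) ^+ m * f m.
Proof.
elim: m => [|m IHm]; first by rewrite big_ord0 expr0 mul1r subrr.
by rewrite big_ord_recr /= IHm exprS mulN1r mulNr opprK mulrDr addrA subrK.
Qed.

(** By the binomial theorem the left side is the sum of (-1)^a (a^n + (a + 1)^n), which telescopes;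
    the end term at q contributes another 0^n, since q = 0 in Z/q and q is odd. *)
Lemma alt_power_sum_rec (q n : nat) : (1 < q)%N -> odd q ->
  alt_power_sum q n + \sum_(i < n.+1) 'C(n, i)%:R * alt_power_sum q i =
  2 * (n == 0)%:R.
Proof.
move=> q_gt1 q_odd; rewrite /alt_power_sum.
under [X in _ + X]eq_bigr do rewrite mulr_sumr.
rewrite exchange_big -big_split /=.
rewrite (eq_bigr (fun a : 'I_q =>
  (-1) ^+ a * (a%:R ^+ n + a.+1%:R ^+ n))) => [|a _].
  rewrite (alt_sum_telescope (fun a => a%:R ^+ n)) -signr_odd q_odd.
  by rewrite pchar_Zp // expr0n expr1 mulN1r opprK mulr_natl mulr2n.
rewrite mulrDr -[in RHS]nat1r exprDn mulr_sumr; congr (_ + _).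
by apply: eq_bigr => i _; rewrite expr1n mul1r mulrCA mulr_natl.
Qed.

Lemma reduces_euler0 (q n : nat) : (1 < q)%N -> odd q ->
  reduces (euler0 n) (alt_power_sum q n).
Proof.
move=> q_gt1 q_odd; have c2q : coprime 2 q by rewrite coprime2n.
(* Solving the common recurrence for its top term only divides by 2, so one formula serves [rat] and
   ['Z_q]. *)
have recE (R : comUnitRingType) (e : nat -> R) : 2%:R \is a @GRing.unit R ->
    (forall n, e n + \sum_(i < n.+1) 'C(n, i)%:R * e i = 2 * (n == 0)%:R) ->
  forall n, e n = (2 * (n == 0)%:R - \sum_(i < n) 'C(n, i)%:R * e i) / 2%:R.
  move=> u2 eE k; apply: (mulIr u2); rewrite divrK // -eE.
  by rewrite big_ord_recr /= binn; ring.
elim/ltn_ind: n => n IHn.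
rewrite (recE _ _ _ euler0_rec) //.
rewrite (recE _ (alt_power_sum q) _ (fun n => alt_power_sum_rec n q_gt1 q_odd));
  last exact: unitr_natZp.
apply: reduces_div => //; apply: reducesD.
  by apply: reducesM; [exact: (reduces_nat q 2) | exact: reduces_nat].
apply/reducesN/reduces_sum => i _.
by apply: reducesM; [exact: reduces_nat | exact: IHn].
Qed.

(** * The cyclic convolution K of h with itself, over a finite commutative ring *)

(* MathComp sets [x^-1 = x] for nonunits; here they are sent to [0]. *)
Definition inv0 (R : unitRingType) (x : R) : R :=
  if x \is a GRing.unit then x^-1 else 0.

Lemma inv0M (R : comUnitRingType) (x y : R) : inv0 (x * y) = inv0 x * inv0 y.
Proof.
rewrite /inv0 unitrM.
case: ifPn => [/andP[ux uy]|]; first by rewrite ux uy invrM // mulrC.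
by rewrite negb_and => /orP[] /negbTE->; rewrite ?mul0r ?mulr0.
Qed.

Lemma inv0N (R : unitRingType) (x : R) : inv0 (- x) = - inv0 x.
Proof. by rewrite /inv0 unitrN invrN; case: ifP => // _; rewrite oppr0. Qed.

Definition inv0_conv (R : finComUnitRingType) (x : R) : R :=
  \sum_y inv0 y * inv0 (x - y).

(** Substitute y = x z and use multiplicativity of [inv0]. *)
Lemma inv0_conv_unit (R : finComUnitRingType) (x : R) : x \is a GRing.unit ->
  inv0_conv x = inv0 x ^+ 2 * inv0_conv 1.
Proof.
move=> ux; rewrite /inv0_conv (reindex_inj (mulrI ux)) mulr_sumr.
apply: eq_bigr => y _; rewrite -{2}[x]mulr1 -mulrBr !inv0M; ring.
Qed.

Lemma sum_odd_eq0 (R : finComUnitRingType) (P : pred R) (F : R -> R) :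
  (2%:R : R) \is a GRing.unit -> (forall x, P (- x) = P x) ->
  (forall x, F (- x) = - F x) -> \sum_(x | P x) F x = 0.
Proof.
move=> u2 PN FN; apply: (mulrI u2); rewrite mulr0 mulr_natl mulr2n.
rewrite {1}(reindex_inj oppr_inj) (eq_bigl _ _ PN) -big_split big1 //= => x _.
by rewrite FN addNr.
Qed.

Lemma inv0_conv1 (R : finComUnitRingType) : (2%:R : R) \is a GRing.unit ->
  (forall x : R, (x \is a GRing.unit) || (1 - x \is a GRing.unit)) ->
  inv0_conv (1 : R) = - 2 * #|[pred x : R | x \isn't a GRing.unit]|%:R.
Proof.
move=> u2 loc; rewrite /inv0_conv.
pose U := [pred y : R | (y \is a GRing.unit) && (1 - y \is a GRing.unit)].
have subK : involutive (fun y : R => 1 - y) by move=> y; rewrite subKr.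
(* Partial fractions: 1 / (y (1 - y)) = 1 / y + 1 / (1 - y). *)
transitivity (\sum_(y in U) (y^-1 + (1 - y)^-1)).
  rewrite [RHS]big_mkcond; apply: eq_bigr => y _; rewrite inE /= /inv0.
  case: ifP => uy; last by rewrite mul0r.
  case: ifP => uy1; last by rewrite mulr0.
  by rewrite -[LHS]mulr1 -[X in _ * X = _](subrK y 1) mulrDr mulrVK // [_ * y]mulrC mulVKr.
rewrite big_split /= [X in _ + X](reindex_inj (inv_inj subK)) /=.
rewrite [X in _ + X](eq_big U (fun y => y^-1)) => [|y|y _]; last first.
- by rewrite subKr.
- by rewrite !inE subKr andbC.
(* By oddness the inverses of all units sum to 0, so the sum over [U] is minus the sum over the
   units y with 1 - y a nonunit. *)
have sumU : \sum_(y : R | y \is a GRing.unit) y^-1 = 0.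
  by apply: sum_odd_eq0 => // x; rewrite ?unitrN ?invrN.
rewrite (bigID (fun y => 1 - y \is a GRing.unit)) /= in sumU.
move/eqP: sumU; rewrite addr_eq0 => /eqP ->.
rewrite -opprD -mulr2n -[_ *+ 2]mulr_natl -mulNr; congr (_ * _).
(* Inversion permutes the whole ring, as it fixes nonunits. It preserves the range because 1 - 1/y =
   -(1 - y)/y, and [loc] makes y a unit there. *)
rewrite (reindex_inj invr_inj).
transitivity (\sum_(y : R | 1 - y \isn't a GRing.unit) y).
  apply: eq_big => [y|y _]; last exact: invrK.
  rewrite unitrV; case uy: (y \is a GRing.unit) => /=; last first.
    by have := loc y; rewrite uy /= => ->.
  have -> : 1 - y^-1 = - (y^-1 * (1 - y)) by rewrite mulrBr mulr1 mulVr // opprB.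
  by rewrite unitrN unitrMr // unitrV.
(* Now 1 - y is summed over the nonunits y, which themselves sum to 0 by oddness. *)
rewrite (reindex_inj (inv_inj subK)) /=.
under eq_bigl do rewrite subKr.
rewrite sumrB [X in _ - X]sum_odd_eq0 // => [|x]; last by rewrite unitrN.
by rewrite subr0 sumr_const.
Qed.

(** * Units and nonunits of Z/p^r *)

Lemma pfactor_gt1 (p r : nat) : prime p -> (0 < r)%N -> (1 < p ^ r)%N.
Proof. by move=> p_pr r_gt0; rewrite -(exp1n r) ltn_exp2r ?prime_gt1. Qed.

Lemma sum_natr_Zp (q : nat) (V : nmodType) (F : 'Z_q -> V) : (1 < q)%N ->
  \sum_(0 <= i < q) F i%:R = \sum_x F x.
Proof.
move=> q_gt1; rewrite -[X in \sum_(0 <= i < X) _](Zp_cast q_gt1) big_mkord.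
by apply: eq_bigr => i _; rewrite natr_Zp.
Qed.

Lemma card_nonunit_Zp (p r : nat) : prime p -> (0 < r)%N ->
  #|[pred x : 'Z_(p ^ r) | x \isn't a GRing.unit]| = (p ^ r.-1)%N.
Proof.
move=> p_pr r_gt0; have q_gt1 := pfactor_gt1 p_pr r_gt0.
have := cardC [pred x : 'Z_(p ^ r) | x \is a GRing.unit].
have -> : #|{: 'Z_(p ^ r)}| = (p ^ r)%N by rewrite card_ord Zp_cast.
have := card_units_Zp (ltnW q_gt1); rewrite cardsT card_sub => ->.
rewrite totient_pfactor //.
have qE : (p ^ r = p.-1 * p ^ r.-1 + p ^ r.-1)%N.
  by rewrite -mulSnr prednK ?prime_gt0 // -expnS prednK.
by rewrite [X in _ = X]qE => /addnI <-; apply: eq_card.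
Qed.

Lemma unit_Zp_pfactor (p r : nat) (a : nat) : prime p -> (0 < r)%N ->
  ((a%:R : 'Z_(p ^ r)) \is a GRing.unit) = ~~ (p %| a)%N.
Proof.
move=> p_pr r_gt0; have q_gt1 := pfactor_gt1 p_pr r_gt0.
by rewrite unitZpE // coprime_pexpl // prime_coprime.
Qed.

Lemma Zp_pfactor_local (p r : nat) (x : 'Z_(p ^ r)) : prime p -> (0 < r)%N ->
  (x \is a GRing.unit) || (1 - x \is a GRing.unit).
Proof.
move=> p_pr r_gt0; have q_gt1 := pfactor_gt1 p_pr r_gt0.
rewrite -(natr_Zp x) -[1 - _]natr_Zp !unit_Zp_pfactor // -negb_and.
(* The representatives of x and 1 - x add up to 1 modulo p^r, hence modulo p. *)
rewrite natr_Zp; apply/negP => /andP[px px1]; have : (p %| 1)%N.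
  have /(congr1 (@nat_of_ord _)) : (x + (1 - x)%R)%N%:R = 1%:R :> 'Z_(p ^ r).
    by rewrite natrD !natr_Zp addrC subrK.
  rewrite !val_Zp_nat // => xE.
  have p_dvd_q : (p %| p ^ r)%N by rewrite dvdn_exp.
  rewrite /dvdn -(modn_dvdm 1 p_dvd_q) -xE modn_dvdm //.
  exact: dvdn_add.
by rewrite dvdn1 => /eqP p1; rewrite p1 in p_pr.
Qed.

(** * From the sum over triples to K(1) *)

Definition nat_conv (R : pzRingType) (f : nat -> R) (n : nat) : R :=
  \sum_(0 <= j < n.+1) f j * f (n - j)%N.

(** The first q indices form a full period and give K(n); shifting the others by q gives C(n). *)
Lemma inv0_nat_conv_addq (q n : nat) (f := fun i => inv0 (i%:R : 'Z_q)) :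
  (1 < q)%N ->
  nat_conv f (q + n) = inv0_conv (n%:R : 'Z_q) + nat_conv f n.
Proof.
move=> q_gt1; rewrite /nat_conv (@big_cat_nat _ _ _ q) //=; last by lia.
have qE (i : nat) : (i + q)%:R = i%:R :> 'Z_q.
  by rewrite natrD pchar_Zp ?addr0.
congr (_ + _).
  rewrite /inv0_conv -sum_natr_Zp //; apply: eq_big_nat => i /andP[_ lt_iq].
  by rewrite /f natrB ?[(q + n)%N]addnC ?qE //; lia.
rewrite -[X in \sum_(X <= i < _) _]add0n big_addn [X in \sum_(0 <= i < X) _](_ : _ = n.+1).
  by apply: eq_bigr => i _; rewrite /f qE addnC subnDr.
by lia.
Qed.

Lemma alt_inv0_conv (q : nat) (f := fun i => inv0 (i%:R : 'Z_q)) :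
  (1 < q)%N -> odd q ->
  \sum_(0 <= i < (2 * q).+1) (-1) ^+ i * f i * nat_conv f (2 * q - i) =
  inv0_conv (1 : 'Z_q) * \sum_(0 <= i < q) (-1) ^+ i * f i ^+ 3.
Proof.
move=> q_gt1 q_odd; rewrite (@big_cat_nat _ _ _ q) //=; last by lia.
have qE (i : nat) : (i + q)%:R = i%:R :> 'Z_q.
  by rewrite natrD pchar_Zp ?addr0.
rewrite -[X in _ + \sum_(X <= i < _) _]add0n big_addn [X in _ + \sum_(0 <= i < X) _](_ : _ = q.+1);
  last by lia.
(* The last term, i = 2q, drops out because h(0) = 0. *)
rewrite [X in _ + X]big_nat_recr //= [f (q + q)%N]/f qE pchar_Zp //.
rewrite /inv0 unitr0 mulr0 mul0r addr0 -big_split mulr_sumr.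
apply: eq_big_nat => i /andP[_ lt_iq] /=.
have -> : (2 * q - i = q + (q - i))%N by lia.
have -> : (2 * q - (i + q) = q - i)%N by lia.
(* The signs at i and i + q are opposite, so the two copies of C(q - i) cancel and K(-i) remains. *)
rewrite inv0_nat_conv_addq // exprD -[(-1) ^+ q]signr_odd q_odd expr1 /f qE.
rewrite natrB ?(ltnW lt_iq) // pchar_Zp // sub0r.
have [ui|nui] := boolP ((i%:R : 'Z_q) \is a GRing.unit); last first.
  by rewrite /inv0 (negbTE nui) expr0n /= !mulr0 !mul0r addr0.
by rewrite inv0_conv_unit ?unitrN // inv0N; ring.
Qed.

Lemma triple_sum_conv (R : comPzRingType) (f : nat -> R) (s : nat -> R) (n : nat) :
  \sum_(i < n.+1) \sum_(j < n.+1) \sum_(k < n.+1 | (i + j + k == n)%N)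
     s i * f i * f j * f k =
  \sum_(0 <= i < n.+1) s i * f i * nat_conv f (n - i).
Proof.
rewrite big_mkord; apply: eq_bigr => i _; rewrite /nat_conv big_mkord mulr_sumr.
have le_in : (i <= n)%N by rewrite -ltnS.
have le_ni : ((n - i).+1 <= n.+1)%N by lia.
rewrite (big_ord_widen _ (fun j => s i * f i * (f j * f (n - i - j)%N)) le_ni).
rewrite [RHS]big_mkcond; apply: eq_bigr => j _.
case: ifP => lt_j; last first.
  by rewrite big_pred0 // => k; apply/negP => /eqP ijk; lia.
have lt_k : (n - i - j < n.+1)%N by lia.
rewrite (big_pred1 (Ordinal lt_k)) ?mulrA // => k /=.
by rewrite -(inj_eq val_inj) /=; lia.
Qed.

(** * Congruences modulo p inside Z/p^r, through the factor p^(r-1) *)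

Lemma pmul_natr_modn (p r a : nat) : prime p -> (0 < r)%N ->
  (p ^ r.-1)%:R * (a %% p)%N%:R = (p ^ r.-1)%:R * a%:R :> 'Z_(p ^ r).
Proof.
move=> p_pr r_gt0; rewrite {2}(divn_eq a p) natrD mulrDr.
rewrite -[_ * (_ * _)%:R]natrM mulnCA -expnSr prednK // natrM.
by rewrite pchar_Zp ?pfactor_gt1 // mulr0 add0r.
Qed.

Lemma pmul_natr_dvd (p r a : nat) : prime p -> (0 < r)%N -> (p %| a)%N ->
  (p ^ r.-1)%:R * a%:R = 0 :> 'Z_(p ^ r).
Proof. by move=> ? ? /eqP pa; rewrite -pmul_natr_modn // pa mulr0. Qed.

Lemma pmul_fermat (p r : nat) (x : 'Z_(p ^ r)) : prime p -> (0 < r)%N ->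
  (p ^ r.-1)%:R * x ^+ p = (p ^ r.-1)%:R * x.
Proof.
move=> p_pr r_gt0; rewrite -(natr_Zp x) -natrX -pmul_natr_modn //.
by rewrite fermat_little // pmul_natr_modn.
Qed.

(** For units this is Fermat: x^(m+3) = 1 modulo p. At nonunits, which are multiples of p, the right
    side vanishes since m > 0. *)
Lemma pmul_inv0_cube (p r m : nat) (x : 'Z_(p ^ r)) :
  prime p -> (0 < r)%N -> (0 < m)%N -> (p.-1 %| m + 3)%N ->
  (p ^ r.-1)%:R * inv0 x ^+ 3 = (p ^ r.-1)%:R * x ^+ m.
Proof.
move=> p_pr r_gt0 m_gt0 /dvdnP[k mE]; rewrite /inv0; case: ifP => ux; last first.
  rewrite expr0n mulr0 -(prednK m_gt0) exprS mulrA -{1}(natr_Zp x).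
  rewrite pmul_natr_dvd ?mul0r //; apply: negbFE.
  by rewrite -(@unit_Zp_pfactor _ r) // natr_Zp.
apply: (mulIr (unitrX 3 ux)); rewrite exprVn divrK ?unitrX // -mulrA -exprD.
rewrite {m m_gt0}mE mulnC; elim: k => [|k IHk]; first by rewrite muln0 mulr1.
rewrite mulnS exprD mulrA; suff -> : (p ^ r.-1)%:R * x ^+ p.-1 = (p ^ r.-1)%:R by [].
by apply: (mulIr ux); rewrite -mulrA -exprSr prednK ?prime_gt0 // pmul_fermat.
Qed.

(** * Identification of B_(p-3) and conclusion *)

Lemma reduces_bernoulli (p r : nat) : prime p -> odd p -> (0 < r)%N ->
  @reduces (p ^ r) ((p ^ (r - 1))%N%:R * bernoulli (p - 3))
    (inv0_conv 1 * \sum_(0 <= i < p ^ r) (-1) ^+ i * inv0 i%:R ^+ 3).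
Proof.
move=> p_pr p_odd r_gt0; have q_gt1 := pfactor_gt1 p_pr r_gt0.
have q_odd : odd (p ^ r) by rewrite oddX p_odd orbT.
have u2 : (2%:R : 'Z_(p ^ r)) \is a GRing.unit.
  by apply: unitr_natZp => //; rewrite coprime2n.
rewrite inv0_conv1 // => [|x]; last exact: Zp_pfactor_local.
rewrite card_nonunit_Zp // subn1; set P : 'Z_(p ^ r) := (p ^ r.-1)%:R.
have sumE (m : nat) : (0 < m)%N -> (p.-1 %| m + 3)%N ->
    - 2 * P * \sum_(0 <= i < p ^ r) (-1) ^+ i * inv0 i%:R ^+ 3 =
    - 2 * P * alt_power_sum (p ^ r) m.
  move=> m_gt0 pm; rewrite -!mulrA /alt_power_sum big_mkord; congr (_ * _).
  rewrite !mulr_sumr; apply: eq_bigr => i _.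
  by rewrite mulrCA (pmul_inv0_cube _ p_pr r_gt0 m_gt0 pm) mulrCA.
have p_gt2 := odd_prime_gt2 p_odd p_pr.
(* For p = 3 the exponent is m = 1: the recurrence at 0 and 1 gives S_0 = 1 and -2 S_1 = 1 = B_0 for
   the alternating sums S_n. *)
have [p3|p_neq3] := eqVneq p 3.
  have -> : (p - 3 = 0)%N by lia.
  rewrite bernoulli0 (@sumE 1) //; last by rewrite p3.
  have := alt_power_sum_rec 1 q_gt1 q_odd.
  have := alt_power_sum_rec 0 q_gt1 q_odd.
  rewrite !big_ord_recr !big_ord0 /= !add0r !mul1r mulr1.
  rewrite -mulr2n -[_ *+ 2]mulr_natl -{3}[2]mulr1 => /(mulrI u2) ->.
  rewrite mulr0 addrCA -mulr2n -[_ *+ 2]mulr_natl => /eqP.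
  rewrite addrC addr_eq0 => /eqP e1.
  have -> : - 2 * P * alt_power_sum (p ^ r) 1 = P; last exact: reduces_nat.
  transitivity (P * - (2%:R * alt_power_sum (p ^ r) 1)); first by ring.
  by rewrite e1 opprK mulr1.
have p_gt4 : (4 < p)%N.
  suff : p != 4 by move: p_neq3 p_gt2; clear; lia.
  by apply: contraL p_pr => /eqP->.
rewrite (@sumE (p - 4)%N); [| by lia | by rewrite -subn1; apply/dvdnP; exists 1%N; lia].
set e := alt_power_sum _ _.
(* Up to sign, [d] is the factor 2 - 2^(n+2) of [euler0 n] at n = p - 4. Fermat gives 2d = -3 modulo
   p, so [d] is a unit as p > 3. *)
pose d := (2 ^ (p - 2) - 2)%N.
have le4 : (2 ^ 2 <= 2 ^ (p - 2))%N by rewrite leq_exp2l //; lia.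
have d_gt0 : (0 < d)%N by rewrite /d; lia.
have dE : (2 * (2 * d + 3) = 2 ^ p - 2)%N.
  have -> : (2 ^ p = 4 * 2 ^ (p - 2))%N by rewrite -(expnD 2 2) subnKC // ltnW.
  by rewrite /d; lia.
have pd : (p %| 2 * d + 3)%N.
  rewrite -(@Gauss_dvdr _ 2) ?coprimen2 // dE -eqn_mod_dvd.
    by apply/eqP/fermat_little.
  by rewrite -{1}(expn1 2) leq_exp2l // prime_gt0.
have cd : coprime d (p ^ r).
  rewrite coprime_pexpr // coprime_sym prime_coprime //.
  apply: contraL pd => pd; rewrite dvdn_addr ?dvdn_mull //.
  by rewrite gtnNdvd // ; lia.
have -> : bernoulli (p - 3) = - (euler0 (p - 4)%N * (p - 3)%N%:R) / d%:R.
  rewrite /euler0 (_ : (p - 4).+2 = p - 2)%N; last by lia.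
  rewrite (_ : (p - 4).+1 = p - 3)%N; last by lia.
  have -> : 2 - 2 ^+ (p - 2) = - d%:R :> rat.
    rewrite /d natrB ?natrX ?opprB // -{1}(expn1 2) leq_exp2l //; lia.
  by field; rewrite !pnatr_eq0; lia.
(* Modulo p both 2d and p - 3 equal -3, so after multiplication by [d] both sides become 3 P e. *)
have -> : - 2 * P * e = P * (- (e * (p - 3)%N%:R) / d%:R).
  apply: (mulIr (unitr_natZp q_gt1 cd)); rewrite -[in RHS]mulrA divrK ?unitr_natZp //.
  have : P * (2 * d + 3)%N%:R = 0 by apply: pmul_natr_dvd.
  have : P * (p - 3 + 3)%N%:R = 0 by apply: pmul_natr_dvd => //; rewrite subnK.
  rewrite natrD => Pp; rewrite natrD natrM => Pd.
  transitivity (- e * (P * (2 * d%:R + 3)) + 3 * P * e); first by ring.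
  rewrite Pd.
  transitivity (- e * (P * ((p - 3)%N%:R + 3)) + 3 * P * e); last by ring.
  by rewrite Pp.
apply: reducesM; first exact: reduces_nat.
apply: reduces_div => //; apply/reducesN/reducesM; last exact: reduces_nat.
exact: reduces_euler0.
Qed.

Theorem theorem1 (p r : nat) (hp : prime p) (hodd : odd p) (hr : (0 < r)%N) :
  eqmodp p r
    (\sum_(i < (2 * p ^ r).+1) \sum_(j < (2 * p ^ r).+1)
       \sum_(k < (2 * p ^ r).+1 |
             [&& (i + j + k == 2 * p ^ r)%N, coprime_pos p i,
                 coprime_pos p j & coprime_pos p k])
         ((-1) ^+ i / (i * j * k)%N%:R))
    ((p ^ (r - 1))%N%:R * bernoulli (p - 3)).
Proof.
have q_gt1 := pfactor_gt1 hp hr.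
have q_odd : odd (p ^ r) by rewrite oddX hodd orbT.
apply: (reduces_eqmodp q_gt1 hr _ (reduces_bernoulli hp hodd hr)).
rewrite -alt_inv0_conv // -triple_sum_conv.
apply: reduces_sum => i _; apply: reduces_sum => j _.
(* The coprimality conditions move into the summand, to match the zeros of [inv0] at nonunits. *)
rewrite big_mkcondr /=; apply: reduces_sum => k _.
have unitE (a : nat) : coprime_pos p a = ((a%:R : 'Z_(p ^ r)) \is a GRing.unit).
  rewrite unit_Zp_pfactor // /coprime_pos /= coprime_sym prime_coprime //.
  by case: a => //; rewrite dvdn0.
rewrite !unitE /inv0.
case ui: (_ \is a GRing.unit); last by rewrite mulr0 !mul0r; apply: (reduces_nat _ 0).
case uj: (_ \is a GRing.unit); last by rewrite mulr0 !mul0r; apply: (reduces_nat _ 0).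
case uk: (_ \is a GRing.unit); last by rewrite mulr0; apply: (reduces_nat _ 0).
have -> : (-1) ^+ i * (i%:R : 'Z_(p ^ r))^-1 * j%:R^-1 * k%:R^-1 =
    (-1) ^+ i / (i * j * k)%N%:R.
  by rewrite !natrM !invrM ?unitrM ?ui ?uj //; ring.
apply: reduces_div (reduces_sign _ _) => //.
by rewrite coprime_sym -unitZpE // !natrM !unitrM ui uj uk.
Qed.
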